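(* Let $q\geq 1$ and $n\geq 3$ be integers and let $X$ be a connected $(q+1)$-regular undirected graph of finite order $n$ (loops and multiple edges allowed). Let $\{h_k\}_{k=1}^\infty$ be the sequence of Maclaurin coefficients given by $\frac{d}{du}\ln \Xi(q^{-\frac12}u)=\sum_{k=0}^\infty h_{k+1}u^k$, where $\Xi$ is the Ihara xi function of $X$. If there is a positive even integer $k$ with $h_k\geq 0$, then for every nontrivial eigenvalue $\lambda$ of $X$, $$ |\lambda|\leq \begin{cases} (1+\sqrt[k]{4n-7})\,q^{\frac12} & \text{if $X$ is nonbipartite},\\ (1+\sqrt[k]{2n-7})\,q^{\frac12} & \text{if $X$ is bipartite}. \end{cases} $$
   Context: Graphs: $X$ is an undirected graph of finite order (number of vertices) $n$, loops and multiple edges allowed. Each edge (including each loop) is given two opposite orientations, called oriented edges. The valency of a vertex $x$ is the number of oriented edges with initial vertex $x$; $X$ is $(q+1)$-regular if every vertex has valency $q+1$. The adjacency matrix $A$ has $(x,y)$-entry equal to the number of oriented edges from $x$ to $y$; its (real) eigenvalues are the eigenvalues of $X$. A walk is a nonempty finite sequence of oriented edges in which the terminal vertex of each is the initial vertex of the next; its length is the number of oriented edges. $X$ is connected if there is a walk between any two distinct vertices. A cycle is a walk from a vertex to itself; $X$ is bipartite if all cycles have even length. A walk has backtracking if some oriented edge is immediately followed by its opposite. A cycle is geodesic if all its cyclic shifts are backtrackless. $N_k$ ($k\ge1$) is the number of geodesic cycles of length $k$. The Ihara zeta function $Z(u)$ is the analytic continuation of $\exp\left(\sum_{k=1}^\infty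 \frac{N_k}{k}u^k\right)$. Eigenvalues of $X$ with absolute value $q+1$ are trivial; the others are nontrivial. The Ihara xi function $\Xi(u)$ is defined by $$\Xi(u)^{-1}=(1-u)(1-qu)(1-q^{\frac12}u)^{2n-2}(1-u^2)^{\frac{n(q-1)}{2}}Z(u)$$ if $X$ is nonbipartite, and by $$\Xi(u)^{-1}=(1-q^2u^2)(1-q^{\frac12}u)^{2n-4}(1-u^2)^{\frac{n(q-1)}{2}+1}Z(u)$$ if $X$ is bipartite. *)

(* Defs.v *)
From mathcomp Require Import all_boot all_order all_algebra.
From mathcomp Require Import complex.
From mathcomp Require Import all_classical all_reals all_analysis.
Set Implicit Arguments.
Unset Strict Implicit.
Unset Printing Implicit Defensive.
Import Order.TTheory GRing.Theory Num.Theory.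
Import numFieldNormedType.Exports.
Local Open Scope ring_scope.
Local Open Scope complex_scope.
Local Open Scope classical_set_scope.

(* The order of the pair [ends e] is an arbitrary reference orientation of the
   edge [e]; loops are the edges whose two ends coincide. *)
Record multigraph := Multigraph {
  vertex : finType;
  edge : finType;
  ends : edge -> vertex * vertex
}.

(* [(e, true)] is [e] with its reference orientation, [(e, false)] its opposite.
   In particular a loop gives rise to two distinct oriented edges. *)
Definition oedge (X : multigraph) : finType := (edge X * bool)%type.

Definition src (X : multigraph) (e : oedge X) : vertex X :=
  if e.2 then (ends e.1).1 else (ends e.1).2.

Definition dst (X : multigraph) (e : oedge X) : vertex X :=
  if e.2 then (ends e.1).2 else (ends e.1).1.

Definition opposite (X : multigraph) (e : oedge X) : oedge X := (e.1, ~~ e.2).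

Definition graph_order (X : multigraph) : nat := #|vertex X|.

Definition valency (X : multigraph) (x : vertex X) : nat :=
  #|[pred e : oedge X | src e == x]|.

Definition regular_graph (X : multigraph) (d : nat) : Prop :=
  forall x : vertex X, valency x = d.

(* Vertices are numbered by the canonical enumeration of the type [vertex X]. *)
Definition adjacency (R : realType) (X : multigraph) : 'M[R]_(graph_order X) :=
  \matrix_(i, j)
    #|[pred e : oedge X | (src e == enum_val i) && (dst e == enum_val j)]|%:R.

Definition follows (X : multigraph) : rel (oedge X) :=
  [rel e f | dst e == src f].

Definition walk (X : multigraph) (w : seq (oedge X)) : bool :=
  (w != [::]) && sorted (@follows X) w.

Definition walk_from_to (X : multigraph) (x y : vertex X) (w : seq (oedge X)) :
    bool :=
  if w is e :: w' then [&& walk w, src e == x & dst (last e w') == y]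
  else false.

Definition connected_graph (X : multigraph) : Prop :=
  forall x y : vertex X, x != y -> exists w, walk_from_to x y w.

Definition is_cycle (X : multigraph) (w : seq (oedge X)) : Prop :=
  exists x : vertex X, walk_from_to x x w.

Definition bipartite (X : multigraph) : Prop :=
  forall w : seq (oedge X), is_cycle w -> ~~ odd (size w).

Definition backtrackless (X : multigraph) (w : seq (oedge X)) : bool :=
  sorted [rel e f | f != opposite e] w.

Definition geodesic_cycle (X : multigraph) (w : seq (oedge X)) : Prop :=
  is_cycle w /\ forall i : nat, backtrackless (rot i w).

(* Cycles are sequences, so they are counted with their starting point. *)
Definition num_geodesic (X : multigraph) (k : nat) : nat :=
  #|[pred w : k.-tuple (oedge X) | `[< geodesic_cycle w >]]|.

(* [R[i]] with its field structure exposed, so that the norm topology and the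
   complex derivative of the library apply to it. *)
Definition Cplx (R : realType) : numClosedFieldType := R[i].

Definition toC (R : realType) (x : R) : Cplx R := x%:C.

Definition cexp (R : realType) (z : Cplx R) : Cplx R :=
  toC (expR (complex.Re z)) * (cos (complex.Im z) +i* sin (complex.Im z)).

Definition holomorphic_on (R : realType) (D : set (Cplx R))
    (f : Cplx R -> Cplx R) : Prop :=
  open D /\ forall z : Cplx R, D z -> derivable f z 1.

(* [Z], on the region [D], is an analytic continuation of
   exp (\sum_(k >= 1) N_k / k u^k), which is defined near 0. *)
Definition is_ihara_zeta (R : realType) (X : multigraph) (D : set (Cplx R))
    (Z : Cplx R -> Cplx R) : Prop :=
  [/\ D 0, connected D, holomorphic_on D Z &
    \forall u \near (0 : Cplx R), exists S : Cplx R,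
      series (fun k : nat => (num_geodesic X k.+1)%:R / k.+1%:R * u ^+ k.+1)
        @ \oo --> S /\ Z u = cexp S].

(* For a (q+1)-regular graph n(q+1) is the number of oriented edges, hence even,
   so that the halving of n(q-1) is exact. *)
Definition ihara_xi (R : realType) (X : multigraph) (q : nat)
    (Z : Cplx R -> Cplx R) (u : Cplx R) : Cplx R :=
  let n := graph_order X in
  let sq : Cplx R := toC (Num.sqrt q%:R) in
  if `[< bipartite X >] then
    ((1 - q%:R ^+ 2 * u ^+ 2) * (1 - sq * u) ^+ (2 * n - 4)
      * (1 - u ^+ 2) ^+ ((n * (q - 1))./2 + 1) * Z u)^-1
  else
    ((1 - u) * (1 - q%:R * u) * (1 - sq * u) ^+ (2 * n - 2)
      * (1 - u ^+ 2) ^+ (n * (q - 1))./2 * Z u)^-1.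

(* [L] is a branch of ln F near 0; all branches have the same derivative. *)
Definition is_log_near0 (R : realType) (F L : Cplx R -> Cplx R) : Prop :=
  \forall u \near (0 : Cplx R), derivable L u 1 /\ cexp (L u) = F u.

Definition is_maclaurin (R : realType) (f : Cplx R -> Cplx R)
    (a : nat -> Cplx R) : Prop :=
  \forall u \near (0 : Cplx R), series (fun k : nat => a k * u ^+ k) @ \oo --> f u.

Definition nontrivial_eigenvalue (R : realType) (X : multigraph) (q : nat)
    (l : R) : Prop :=
  eigenvalue (adjacency R X) l /\ `|l| <> q%:R + 1.

(* Main.v *)
(** On the real axis the equation [exp L = Xi] becomes an identity between real
    power series, which gives [h_k = sum_c c^k - q^(-k/2) N_k], where [c] runs
    over the reciprocal zeros of the explicit factors of [Xi^-1] rescaled by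
    [q^(-1/2)].  A recursion for the traces of the powers of the Hashimoto matrix
    (which replaces the Ihara-Bass determinant formula) gives, for even [k],
    [N_k = sum_lambda p_k(lambda) + n(q-1)], where [lambda] runs over the
    eigenvalues of the adjacency matrix and [p_k(a+b) = a^k + b^k] for [ab = q].
    For even [k] and real [x], [p_k(x) = p_(k/2)(x)^2 - 2 q^(k/2) >= -2 q^(k/2)],
    so discarding all eigenvalues but [q+1] and [l], [h_k >= 0] implies
    [p_k(l) <= (4n-6) q^(k/2)]; for a bipartite graph one keeps [q+1], [-(q+1)],
    [l], [-l] and obtains [(2n-6) q^(k/2)].  If [|l| > 2 q^(1/2)], write
    [|l| = q^(1/2) (x + 1/x)] with [x > 1]: then [x^k + x^-k <= M + 1], and by
    convexity [x + 1/x <= M^(1/k) + 1]. *)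

Require Import Defs.
From mathcomp Require Import all_boot all_order all_algebra.
From mathcomp Require Import complex.
From mathcomp Require Import all_classical all_reals all_analysis.
From mathcomp Require Import ring lra.
Import Order.TTheory GRing.Theory Num.Theory.
Import numFieldNormedType.Exports.
Local Open Scope ring_scope.
Local Open Scope classical_set_scope.

Set Implicit Arguments.
Unset Strict Implicit.
Unset Printing Implicit Defensive.

(** * Closed walks and traces of matrix powers *)

Lemma big_cons_tuple (V : nmodType) (T : finType) (k : nat)
    (F : T -> k.-tuple T -> V) (G : k.+1.-tuple T -> V) :
  (forall x p, G (cons_tuple x p) = F x p) ->
  \sum_(w : k.+1.-tuple T) G w = \sum_(x : T) \sum_(p : k.-tuple T) F x p.
Proof.
move=> FG; rewrite pair_bigA /=.
rewrite (reindex (fun xp : T * k.-tuple T => cons_tuple xp.1 xp.2)) /=.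
  by apply: eq_bigr => xp _; rewrite FG.
exists (fun w => (thead w, behead_tuple w)).
  by case=> x p _; congr (_, _); apply: val_inj.
by move=> w _; rewrite [RHS]tuple_eta; apply: val_inj.
Qed.

Definition rel_mx (R : pzRingType) (T : finType) (r : rel T) : 'M[R]_#|T| :=
  \matrix_(i, j) (r (enum_val i) (enum_val j))%:R.

Lemma rel_mxX (R : pzRingType) (T : finType) (r : rel T) (k : nat) (x y : T) :
  (rel_mx R r ^+ k) (enum_rank x) (enum_rank y) =
  \sum_(p : k.-tuple T) (path r x p && (last x p == y))%:R.
Proof.
elim: k x => [|k IH] x.
  rewrite (bigD1 [tuple]) //= big1 => [|p /eqP[]]; last by rewrite [p]tuple0.
  by rewrite addr0 expr0 mxE (inj_eq enum_rank_inj).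
rewrite exprS mxE (reindex enum_rank) /=; last first.
  by apply: onW_bij; apply: enum_rank_bij.
rewrite (@big_cons_tuple _ _ _
  (fun z p => (r x z)%:R * (path r z p && (last z p == y))%:R)); last first.
  by move=> z p /=; case: (r x z); rewrite /= ?mul1r ?mul0r.
by apply: eq_bigr => z _; rewrite mxE !enum_rankK IH mulr_sumr.
Qed.

(** Splitting off the first vertex leaves a path that must return to it. Exponent 0 is excluded: its
    trace is [#|T|], while there is a single empty tuple. *)
Lemma mxtrace_rel_mx (R : pzRingType) (T : finType) (r : rel T) (k : nat) :
  \tr (rel_mx R r ^+ k.+1) = \sum_(w : k.+1.-tuple T) (cycle r w)%:R.
Proof.
rewrite (@big_cons_tuple _ _ _ (fun x p => (path r x p && r (last x p) x)%:R));
  last by move=> x p /=; rewrite rcons_path.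
rewrite /mxtrace (reindex enum_rank) /=; last first.
  by apply: onW_bij; apply: enum_rank_bij.
apply: eq_bigr => x _; rewrite exprSr mxE (reindex enum_rank) /=; last first.
  by apply: onW_bij; apply: enum_rank_bij.
under eq_bigr => y _ do rewrite rel_mxX mulr_suml.
rewrite exchange_big /=; apply: eq_bigr => p _.
rewrite (bigD1 (last x p)) //= big1 => [|y yp].
  by rewrite eqxx mxE !enum_rankK andbT addr0 -natrM mulnb.
by rewrite [last x p == y]eq_sym (negPf yp) andbF mul0r.
Qed.

(** The matrix [rel_mx] of this relation is the Hashimoto edge matrix. *)
Definition nonbacktracking (X : multigraph) : rel (oedge X) :=
  [rel e f | (dst e == src f) && (f != opposite e)].

(** Rotations by 0 and by 1 already test every cyclically consecutive pair, so the conditions on all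
    rotations collapse to one [cycle] condition. Conversely, [cycle] is invariant under rotation. *)
Lemma geodesic_cycleE (X : multigraph) (w : seq (oedge X)) :
  w != [::] -> `[< geodesic_cycle w >] = cycle (@nonbacktracking X) w.
Proof.
move=> w0; apply/asboolP/idP.
  case=> -[x wxx] bt; case: w w0 wxx bt => // e w _ /=.
  case/and3P=> /andP [_ /= se] /eqP sx /eqP dx bt.
  have cyc : cycle (@follows X) (e :: w).
    by rewrite /= rcons_path se /= /follows /= dx sx.
  have := bt 1%N; rewrite rot1_cons => bt1.
  have cycb : cycle [rel e f | f != opposite e] (e :: w).
    rewrite /= rcons_path; have := bt 0%N; rewrite rot0 /backtrackless /= => ->.
    (* No rotation of a cycle of length 1 contains a pair, but its wrap-around pair is [(e, e)], and
       [e] differs from its opposite. *)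
    case: w bt1 {se bt cyc dx} => [_ |f w]; rewrite /=.
      by rewrite /opposite; apply/eqP => /(congr1 snd) /=; case: e.2.
    by rewrite /backtrackless /= rcons_path => /andP [].
  have : path [rel e f | follows e f && (f != opposite e)] e (rcons w e).
    rewrite (path_relI (@follows X) [rel e f | f != opposite e]).
    by apply/andP; split; [exact: cyc | exact: cycb].
  by apply: sub_path.
move=> cw; split; last first.
  move=> i; rewrite /backtrackless.
  have: cycle (@nonbacktracking X) (rot i w) by rewrite rot_cycle.
  case: (rot i w) => //= e s; rewrite rcons_path => /andP [p _].
  by apply: sub_path p => a b /andP [].
case: w w0 cw => // e w _ /=; rewrite rcons_path => /andP [p /andP [/eqP l _]].
exists (src e); rewrite /= eqxx l eqxx andbT /walk /= andbT.
by apply: sub_path p => a b /andP [].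
Qed.

Lemma num_geodesicE (R : pzRingType) (X : multigraph) (k : nat) :
  (num_geodesic X k.+1)%:R = \tr (rel_mx R (@nonbacktracking X) ^+ k.+1).
Proof.
rewrite mxtrace_rel_mx /num_geodesic -sum1_card natr_sum big_mkcond /=.
apply: eq_bigr => w _; rewrite unfold_in /= geodesic_cycleE; first by case: cycle.
by rewrite -size_eq0 size_tuple.
Qed.

(** * Lucas polynomials and traces of powers of the Hashimoto matrix *)

Fixpoint lucasU (R : pzRingType) (q : nat) (x : R) (k : nat) : R :=
  if k is k1.+1 then
    if k1 is k2.+1 then x * lucasU q x k1 - lucasU q x k2 *+ q else 1
  else 0.

(** For [x = a + b] with [a b = q] and [a], [b] distinct in a field, [lucasU] is
    [(a^k - b^k) / (a - b)] and [lucasV] is [a^k + b^k], the [p_k] of the overview. The ring may be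
    noncommutative, so that [x] can be a square matrix. *)
Definition lucasV (R : pzRingType) (q : nat) (x : R) (k : nat) : R :=
  lucasU q x k.+1 *+ 2 - x * lucasU q x k.

Arguments lucasU : simpl never.

Lemma lucasU0 (R : pzRingType) (q : nat) (x : R) : lucasU q x 0 = 0.
Proof. by []. Qed.

Lemma lucasU1 (R : pzRingType) (q : nat) (x : R) : lucasU q x 1 = 1.
Proof. by []. Qed.

Lemma lucasUSS (R : pzRingType) (q : nat) (x : R) (k : nat) :
  lucasU q x k.+2 = x * lucasU q x k.+1 - lucasU q x k *+ q.
Proof. by []. Qed.

Lemma lucasVS (R : pzRingType) (q : nat) (x : R) (k : nat) :
  lucasV q x k.+1 = x * lucasU q x k.+1 - lucasU q x k *+ (q * 2).
Proof. by rewrite /lucasV lucasUSS mulrnBl -mulrnA mulr2n addrAC addrK. Qed.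

Lemma lucasU_rmorph (R S : pzRingType) (f : {rmorphism R -> S}) (q : nat)
    (x : R) (k : nat) : lucasU q (f x) k = f (lucasU q x k).
Proof.
suff [] : lucasU q (f x) k = f (lucasU q x k) /\
          lucasU q (f x) k.+1 = f (lucasU q x k.+1) by [].
elim: k => [|k [IH1 IH2]]; first by rewrite !lucasU0 !lucasU1 rmorph0 rmorph1.
split=> //; by rewrite !lucasUSS IH1 IH2 rmorphB rmorphM rmorphMn.
Qed.

Lemma lucasV_rmorph (R S : pzRingType) (f : {rmorphism R -> S}) (q : nat)
    (x : R) (k : nat) : lucasV q (f x) k = f (lucasV q x k).
Proof. by rewrite /lucasV !lucasU_rmorph rmorphB rmorphM rmorphMn. Qed.

Lemma lucasV_root (R : comPzRingType) (q : nat) (a b : R) (k : nat) :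
  a * b = q%:R -> lucasV q (a + b) k = a ^+ k + b ^+ k.
Proof.
move=> ab; suff [] : lucasV q (a + b) k = a ^+ k + b ^+ k /\
    lucasV q (a + b) k.+1 = a ^+ k.+1 + b ^+ k.+1 by [].
have Vrec j : lucasV q (a + b) j.+2 =
    (a + b) * lucasV q (a + b) j.+1 - q%:R * lucasV q (a + b) j.
  rewrite !lucasVS {1}/lucasV !lucasUSS !mulrnA !mulr2n -2!(mulr_natl _ q).
  move: (lucasU q _ j) (lucasU q _ j.+1) => u v; ring.
elim: k => [|k [IH1 IH2]]; first by rewrite /lucasV lucasUSS lucasU0 lucasU1; split; ring.
by split=> //; rewrite Vrec IH1 IH2 -ab !exprS; ring.
Qed.

(* With [T = J S^T] the Hashimoto matrix is [W = T S - J], and [W] maps the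
   column space of [T] and [S^T] into itself, acting there through [A]. *)
Section HashimotoTrace.
Variables (R : comNzRingType) (n m q : nat) (S : 'M[R]_(n, m)) (J : 'M[R]_m).
Hypotheses (JJ : J *m J = 1%:M) (SS : S *m S^T = (q.+1%:R)%:M).
Let A : 'M[R]_n := S *m J *m S^T.
Let W : 'M[R]_m := J *m S^T *m S - J.
Let U k : 'M[R]_n := lucasU q A k.

Let WXT k : W ^+ k *m (J *m S^T) = J *m S^T *m U k.+1 - S^T *m U k.
Proof.
elim: k => [|k IH]; first by rewrite expr0 mul1mx /U lucasU0 lucasU1 mulmx1 mulmx0 subr0.
have WT : W *m (J *m S^T) = J *m S^T *m A - S^T.
  by rewrite mulmxBl [J *m (J *m _)]mulmxA JJ mul1mx /A !mulmxA.
have WS : W *m S^T = (J *m S^T) *+ q.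
  rewrite mulmxBl -[_ *m S *m S^T]mulmxA SS mul_mx_scalar mulrS scalerDl scale1r.
  by rewrite addrC addKr scaler_nat.
rewrite exprS -mulmxE -mulmxA IH mulmxBr !mulmxA WS -[W *m J *m _]mulmxA WT.
rewrite mulmxBl /U lucasUSS mulmxBr -mulmxE mulmxA -addrA -[RHS]addrA; congr (_ + _).
by rewrite addrC -!scaler_nat -scalemxAl scalemxAr.
Qed.

(** Expanding the last factor of [W^(k+2)] as [T S - J] leaves the trace of [W^(k+1) J]. Expanding
    once more with [W J = T S J - 1] brings back [W^k]. The terms containing [T] are evaluated by
    [WXT] after a cyclic shift. *)
Let tr_step k : \tr (W ^+ k.+2) - \tr (W ^+ k) =
  \tr (A *m U k.+2) - q.+1%:R * \tr (U k.+1) *+ 2 + \tr (A *m U k).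
Proof.
have t1 j : \tr (W ^+ j.+1) =
    \tr (A *m U j.+1) - q.+1%:R * \tr (U j) - \tr (W ^+ j *m J).
  rewrite exprSr -mulmxE {2}/W mulmxBr mulmxA linearB /= mxtrace_mulC WXT.
  by rewrite mulmxBr !mulmxA SS mul_scalar_mx linearB linearZ.
have t2 j : \tr (W ^+ j.+1 *m J) =
    q.+1%:R * \tr (U j.+1) - \tr (A *m U j) - \tr (W ^+ j).
  rewrite exprSr -mulmxE {2}/W -mulmxA [in X in _ *m X]mulmxBl JJ mulmxBr mulmx1.
  rewrite linearB /= -[J *m S^T *m S *m J]mulmxA [W ^+ j *m _]mulmxA WXT.
  rewrite mxtrace_mulC mulmxBr.
  rewrite !mulmxA -[S *m J *m J]mulmxA JJ mulmx1 SS mul_scalar_mx.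
  by rewrite linearB linearZ.
rewrite t1 t2; ring.
Qed.

(** By [tr_step] the traces of [W^k] and of [lucasV q A k] have the same increments over two steps,
    so their difference depends only on the parity of [k]. It is [m - 2n] at 0, and [- \tr J = 0] at
    1. *)
Lemma mxtrace_hashimoto (k : nat) : \tr J = 0 ->
  \tr (W ^+ k) = \tr (lucasV q A k) + (if odd k then 0 else m%:R - (n * 2)%:R).
Proof.
move=> J0.
pose c j : R := if odd j then 0 else m%:R - (n * 2)%:R.
suff [] : \tr (W ^+ k) = \tr (lucasV q A k) + c k /\
    \tr (W ^+ k.+1) = \tr (lucasV q A k.+1) + c k.+1 by [].
rewrite /c {c}.
elim: k => [|k [IH1 IH2]].
  split; rewrite /lucasV ?lucasUSS lucasU0 lucasU1 ?mulr0 ?subr0 ?mulr1 /=.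
    by rewrite expr0 raddfMn /= !mxtrace1 natrM; ring.
  rewrite expr1 mul0rn subr0 addr0 linearB /= J0 mxtrace_mulC mulmxA subr0.
  by rewrite mulr2n addrK.
split=> //; move/eqP: (tr_step k); rewrite subr_eq IH1 => /eqP ->.
have trB (M N : 'M[R]_n) : \tr (M - N) = \tr M - \tr N by exact: linearB.
have trMn (M : 'M[R]_n) j : \tr (M *+ j) = \tr M *+ j by exact: raddfMn.
rewrite [odd k.+2]/= negbK lucasVS /lucasV !trB !trMn -!mulmxE.
rewrite -/(U k.+1) -/(U k.+2) -/(U k).
rewrite mulrnA !mulr2n -(mulr_natl _ q).
move: (\tr (_ *m U k.+2)) (\tr (U k.+1)) (\tr (_ *m U k)) => x y z.
move: (if _ then _ else _) => d. ring.
Qed.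
End HashimotoTrace.

(** * Incidence, orientation reversal and adjacency matrices of a graph *)

Section GraphMatrices.
Variables (R : comNzRingType) (X : multigraph).

Lemma sum_enum_val (T : finType) (F : T -> R) :
  \sum_(i < #|T|) F (enum_val i) = \sum_(x : T) F x.
Proof.
rewrite (reindex_onto enum_rank enum_val) /= => [|i _]; last by rewrite enum_valK.
by apply: eq_big => x; rewrite enum_rankK ?eqxx.
Qed.

Lemma oppositeK : involutive (@opposite X).
Proof. by case=> e b; rewrite /opposite negbK. Qed.

Lemma src_opposite (e : oedge X) : src (opposite e) = dst e.
Proof. by case: e => e []. Qed.

Lemma dst_opposite (e : oedge X) : dst (opposite e) = src e.
Proof. by case: e => e []. Qed.

(** This is the [S] of the trace computation, with [opposite_mx] as [J]. The product [S J] is the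
    incidence matrix of terminal vertices, whence [S J S^T] is the adjacency matrix. *)
Definition src_mx : 'M[R]_(#|vertex X|, #|oedge X|) :=
  \matrix_(i, j) (src (enum_val j) == enum_val i)%:R.

Definition opposite_mx : 'M[R]_#|oedge X| :=
  rel_mx R [rel e f : oedge X | f == opposite e].

Lemma mul_opposite_mx (p : nat) (M : 'M[R]_(#|oedge X|, p)) i j :
  (opposite_mx *m M) i j = M (enum_rank (opposite (enum_val i))) j.
Proof.
rewrite mxE (bigD1 (enum_rank (opposite (enum_val i)))) //= big1 ?addr0.
  by rewrite mxE enum_rankK /= eqxx mul1r.
move=> k; rewrite -(inj_eq enum_val_inj) enum_rankK mxE /= => /negPf ->.
by rewrite mul0r.
Qed.

Lemma opposite_mxK : opposite_mx *m opposite_mx = 1%:M.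
Proof.
apply/matrixP => i j; rewrite mul_opposite_mx !mxE enum_rankK /= oppositeK.
by rewrite (inj_eq enum_val_inj) eq_sym.
Qed.

(** Even the two orientations of a loop are distinct, so [opposite] has no fixed point. *)
Lemma mxtrace_opposite_mx : \tr opposite_mx = 0.
Proof.
apply: big1 => i _; rewrite mxE /=; case: eqP => // /(congr1 snd) /=.
by case: (enum_val i).2.
Qed.

Lemma src_mx_mul_tr (d : nat) : regular_graph X d ->
  src_mx *m src_mx^T = d%:R%:M.
Proof.
move=> hreg; apply/matrixP => i j; rewrite !mxE.
under eq_bigr => k _ do rewrite !mxE -natrM mulnb.
rewrite (sum_enum_val
  (fun e : oedge X => ((src e == enum_val i) && (src e == enum_val j))%:R)).
have [<-|ij] := eqVneq i j.
  rewrite mulr1n -(hreg (enum_val i)) /valency -sum1_card natr_sum [RHS]big_mkcond /=.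
  by apply: eq_bigr => e _; rewrite andbb unfold_in /=; case: eqP.
rewrite mulr0n big1 // => e _; case: eqP => //= ->.
by rewrite (inj_eq enum_val_inj) (negPf ij).
Qed.

(** The product records all pairs with [dst e = src f]. Among them is the backtracking pair
    [f = opposite e], which the subtracted matrix removes. *)
Lemma nonbacktracking_mxE :
  rel_mx R (@nonbacktracking X) = opposite_mx *m src_mx^T *m src_mx - opposite_mx.
Proof.
apply/matrixP => i j; rewrite -mulmxA mxE [RHS]mxE mul_opposite_mx !mxE.
under [X in _ = X + _]eq_bigr => k _ do rewrite !mxE -natrM mulnb enum_rankK.
rewrite (sum_enum_val (fun x : vertex X =>
  ((src (opposite (enum_val i)) == x) && (src (enum_val j) == x))%:R)) src_opposite.
rewrite (bigD1 (dst (enum_val i))) //= big1 => [|x]; last first.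
  by rewrite [x == _]eq_sym => /negPf ->.
rewrite eqxx addr0 /=.
rewrite /nonbacktracking /=.
have [->|_] := eqVneq (enum_val j) (opposite (enum_val i)).
  by rewrite src_opposite !eqxx /= subrr.
by rewrite andbT subr0 eq_sym.
Qed.
End GraphMatrices.

Lemma adjacencyE (R : realType) (X : multigraph) :
  adjacency R X = src_mx R X *m opposite_mx R X *m (src_mx R X)^T.
Proof.
apply/matrixP => i j; rewrite -mulmxA mxE [RHS]mxE.
under eq_bigr => k _ do rewrite mul_opposite_mx !mxE enum_rankK -natrM mulnb.
rewrite (sum_enum_val (fun e : oedge X =>
  ((src e == enum_val i) && (src (opposite e) == enum_val j))%:R)).
rewrite -sum1_card natr_sum [LHS]big_mkcond /=; apply: eq_bigr => e _.
by rewrite src_opposite unfold_in /=; case: (_ && _).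
Qed.

Lemma tr_adjacency (R : realType) (X : multigraph) :
  (adjacency R X)^T = adjacency R X.
Proof.
apply/matrixP => i j; rewrite !mxE; congr _%:R.
rewrite -!sum1_card (reindex_inj (inv_inj (@oppositeK X))) /=.
by apply: eq_bigl => e; rewrite !unfold_in /= src_opposite dst_opposite andbC.
Qed.

Lemma card_oedge (X : multigraph) (d : nat) : regular_graph X d ->
  #|oedge X| = (graph_order X * d)%N.
Proof.
move=> hreg; rewrite -sum1_card (partition_big (@src X) predT) //=.
rewrite -sum_nat_const; apply: eq_bigr => x _.
by rewrite -(hreg x) /valency -sum1_card.
Qed.

(** There are [n(q+1)] oriented edges, so the constant [m - 2n] of [mxtrace_hashimoto] becomes
    [n(q-1)]. *)
Lemma num_geodesic_lucas (R : realType) (X : multigraph) (q k : nat) :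
  regular_graph X q.+1 -> (0 < k)%N -> ~~ odd k ->
  (num_geodesic X k)%:R =
  \tr (lucasV q (adjacency R X) k) + ((graph_order X)%:R * (q%:R - 1)) :> R.
Proof.
case: k => // k hreg _ ek; rewrite num_geodesicE nonbacktracking_mxE.
rewrite (@mxtrace_hashimoto R #|vertex X| #|oedge X| q) ?opposite_mxK //.
  by rewrite -adjacencyE (negPf ek) (card_oedge hreg) /graph_order !natrM mulrS; ring.
- exact: src_mx_mul_tr.
- exact: mxtrace_opposite_mx.
Qed.

(** * Spectrum of the adjacency matrix *)

Lemma lucasV_intertwine (R : pzRingType) (q : nat) (p x y : R) (k : nat) :
  p * x = y * p -> p * lucasV q x k = lucasV q y k * p.
Proof.
move=> pxy; have [U1 U2] : p * lucasU q x k = lucasU q y k * p /\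
    p * lucasU q x k.+1 = lucasU q y k.+1 * p.
  elim: k => [|k [IH1 IH2]]; first by rewrite !lucasU0 !lucasU1 mulr0 mul0r mulr1 mul1r.
  split=> //; rewrite !lucasUSS mulrBr mulrBl mulrA pxy -!mulrA IH2 mulrnAr mulrnAl.
  by rewrite IH1.
by rewrite /lucasV mulrBr mulrBl mulrnAr mulrnAl U2 mulrA pxy -!mulrA U1.
Qed.

Lemma lucasV_diag_mx (R : comPzRingType) (n q : nat) (d : 'rV[R]_n) (k : nat) :
  lucasV q (diag_mx d) k = diag_mx (\row_i lucasV q (d 0 i) k).
Proof.
have [U1 U2] : lucasU q (diag_mx d) k = diag_mx (\row_i lucasU q (d 0 i) k) /\
    lucasU q (diag_mx d) k.+1 = diag_mx (\row_i lucasU q (d 0 i) k.+1).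
  elim: k => [|k [IH1 IH2]].
    split; apply/matrixP => i j;
      by rewrite ?lucasU0 ?lucasU1 !mxE ?lucasU0 ?lucasU1 ?mul0rn.
  split=> //; rewrite lucasUSS IH1 IH2 -mulmxE mulmx_diag -raddfMn -raddfB /=.
  by congr diag_mx; apply/rowP => i; rewrite !(mxE, mulmxnE) lucasUSS.
rewrite /lucasV U1 U2 -mulmxE mulmx_diag -raddfMn -raddfB /=.
by congr diag_mx; apply/rowP => i; rewrite !(mxE, mulmxnE).
Qed.

(** The spectral theorem is applied to the complexification [B]. Its diagonal form is real because
    [B] is hermitian, and both conclusions descend to [R] by injectivity of the embedding. *)
Lemma real_symmetric_spectrum (R : rcfType) (n q : nat) (A : 'M[R]_n) :
  A^T = A ->
  exists d : 'I_n -> R,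
    (forall k, \tr (lucasV q A k) = \sum_i lucasV q (d i) k) /\
    (forall l, eigenvalue A l -> exists i, d i = l).
Proof.
move=> symA; pose f : {rmorphism R -> complex R} := real_complex R; pose B := map_mx f A.
have hB : B \is hermsymmx.
  apply: realsym_hermsym.
    by apply/is_hermitianmxP; rewrite expr0 scale1r map_mx_id // /B map_trmx symA.
  by apply/mxOverP => i j; rewrite mxE; apply/complex_realP; exists (A i j).
have /hermitian_normalmx/orthomx_spectralP := hB.
have /mxOverP := hermitian_spectral_diag_real hB.
have := spectral_unit B.
set P := spectralmx B; set D := spectral_diag B => Pu Dr BE.
have PB : P *m B = diag_mx D *m P by rewrite BE !mulmxA mulmxV // mul1mx.
pose d i := complex.Re (D 0 i).
have dE i : f (d i) = D 0 i by apply: RRe_real; apply: Dr.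
exists d; split=> [k|l].
  apply: (@complexI R); rewrite -[LHS]/(f _) -[RHS]/(f _) -trace_map_mx.
  rewrite -(lucasV_rmorph (map_mx f)) -/B.
  have -> : lucasV q B k = invmx P *m lucasV q (diag_mx D) k *m P.
    have PV : P *m lucasV q B k = lucasV q (diag_mx D) k *m P.
      exact: lucasV_intertwine.
    by rewrite -mulmxA -PV mulmxA mulVmx ?mul1mx.
  rewrite mxtrace_mulC mulmxA mulmxV // mul1mx lucasV_diag_mx mxtrace_diag.
  rewrite rmorph_sum /=; apply: eq_bigr => i _.
  by rewrite mxE -dE lucasV_rmorph.
case/eigenvalueP => v vA v0.
(* The eigenvector in the coordinates of the eigenbasis: a nonzero coordinate [i] forces
   [d i = l]. *)
pose w := map_mx f v *m invmx P.
have w0 : w != 0.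
  apply: contra v0 => /eqP w0; rewrite -(map_mx_eq0 f).
  by rewrite -[map_mx f v](mulmxKV Pu) -/w w0 mul0mx.
have wD : w *m diag_mx D = f l *: w.
  have := congr1 (fun M => map_mx f M *m invmx P) vA => /=.
  rewrite map_mxM map_mxZ -scalemxAl -/w => <-; rewrite -/B BE.
  by rewrite -!mulmxA mulmxV // mulmx1 mulmxA.
have /rV0Pn [i wi] := w0; exists i; apply: (@complexI R); rewrite -/(f _) dE.
have /rowP /(_ i) := wD; rewrite mul_mx_diag !mxE mulrC => /(mulIf _); apply.
by move: wi; rewrite !mxE.
Qed.

Lemma eigenvalue_valency (R : realType) (X : multigraph) (d : nat) :
  regular_graph X d -> (0 < graph_order X)%N -> eigenvalue (adjacency R X) d%:R.
Proof.
move=> hreg X0; apply/eigenvalueP.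
exists (const_mx 1); last first.
  apply/rV0Pn; exists (Ordinal X0).
  by rewrite mxE oner_neq0.
apply/rowP => j; rewrite -tr_adjacency !mxE mulr1.
under eq_bigr => i _ do rewrite !mxE mul1r.
rewrite -(hreg (enum_val j)) /valency -sum1_card.
rewrite -natr_sum; congr _%:R.
rewrite [RHS](partition_big (@dst X) predT) //=.
rewrite [RHS](reindex (@enum_val _ (vertex X))) /=; last first.
  by apply: onW_bij; apply: enum_val_bij.
by apply: eq_bigr => i _; rewrite -sum1_card.
Qed.

(** Changing the sign of an eigenvector on one colour class negates its eigenvalue, since nonzero
    adjacency entries join vertices of different colours. *)
Lemma eigenvalue_opp_colouring (R : realType) (X : multigraph)
    (c : vertex X -> bool) (l : R) :
  (forall e : oedge X, c (dst e) = ~~ c (src e)) ->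
  eigenvalue (adjacency R X) l -> eigenvalue (adjacency R X) (- l).
Proof.
move=> hc /eigenvalueP [v vA v0]; apply/eigenvalueP.
pose s (i : 'I_(graph_order X)) : R := (-1) ^+ c (enum_val i).
have ss i : s i * s i = 1.
  by rewrite /s -signr_addb addbb.
exists (\row_i (v 0 i * s i)); last first.
  apply: contra v0 => /eqP w0; apply/eqP/rowP => i.
  move/rowP/(_ i): w0; rewrite !mxE => /(congr1 ( *%R^~ (s i))).
  by rewrite -mulrA ss mulr1 mul0r.
apply/rowP => j; rewrite !mxE mulNr mulrA.
have /rowP/(_ j) := vA; rewrite !mxE => <-.
rewrite mulr_suml -sumrN; apply: eq_bigr => i _; rewrite !mxE.
set N := #|_|; have [->|N0] := posnP N; first by rewrite !mulr0 mul0r oppr0.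
have /card_gt0P [e] := N0.
rewrite unfold_in /= => /andP [/eqP ei /eqP ej].
have -> : s j = - s i by rewrite /s -ei -ej hc; case: (c _); rewrite /= ?opprK.
ring.
Qed.

Lemma walk_from_to_cat (X : multigraph) (x y z : vertex X) (v w : seq (oedge X)) :
  walk_from_to x y v -> walk_from_to y z w -> walk_from_to x z (v ++ w).
Proof.
case: v w => // e v [//|f w] /= /and3P [/andP [_ /= pv] sx /eqP dy].
case/and3P => /andP [_ /= pw] /eqP sy dz.
by rewrite sx last_cat /= dz andbT /walk /= cat_path pv /= pw /follows /= dy sy eqxx.
Qed.

Lemma walk_from_to1 (X : multigraph) (e : oedge X) :
  walk_from_to (src e) (dst e) [:: e].
Proof. by rewrite /= !eqxx. Qed.

(** A vertex is coloured by the parity of a walk from [x0]. This parity is well defined: two walks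
    to the same vertex, closed by a common return walk, are both even cycles. *)
Lemma bipartite_colouring (X : multigraph) :
  connected_graph X -> (1 < graph_order X)%N -> bipartite X ->
  exists c : vertex X -> bool, forall e : oedge X, c (dst e) = ~~ c (src e).
Proof.
move=> hconn /card_gt1P [x0 [x1 [_ _ x01]]] bip.
(* Connectedness speaks of distinct vertices and walks are nonempty, so a walk from [x] to itself
   goes through a second vertex. *)
have reach (x y : vertex X) : exists w, walk_from_to x y w.
  have [<-|xy] := eqVneq x y; last exact: hconn.
  have [z xz] : exists z, x != z.
    have [E|] := eqVneq x x0; last by exists x0.
    by exists x1; rewrite E.
  have [v vw] := hconn x z xz.
  have [w ww] : exists w, walk_from_to z x w by apply: hconn; rewrite eq_sym.
  by exists (v ++ w); apply: walk_from_to_cat vw ww.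
have parity y v w : walk_from_to x0 y v -> walk_from_to x0 y w ->
    odd (size v) = odd (size w).
  move=> hv hw; have [u hu] := reach y x0.
  have /bip : is_cycle (v ++ u) by exists x0; apply: walk_from_to_cat hv hu.
  have /bip : is_cycle (w ++ u) by exists x0; apply: walk_from_to_cat hw hu.
  by rewrite !size_cat !oddD; case: (odd (size u)); case: odd; case: odd.
exists (fun y => odd (size (projT1 (cid (reach x0 y))))) => e.
case: cid => v hv; case: cid => w hw /=.
rewrite (parity _ _ _ hv (walk_from_to_cat hw (walk_from_to1 e))).
by rewrite size_cat addn1.
Qed.

(** * Inequalities for Lucas polynomials at real arguments *)

Lemma lucasV_complex_root (R : rcfType) (q : nat) (x : R) :
  exists a b : complex R, a * b = q%:R /\ a + b = real_complex R x.
Proof.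
pose y := real_complex R x; pose s := sqrtC (y ^+ 2 - 4 * q%:R).
exists ((y + s) / 2), ((y - s) / 2); split; last by field.
rewrite (_ : _ * _ = (y ^+ 2 - s ^+ 2) / 4); last by field.
by rewrite sqrtCK; field.
Qed.

Lemma lucasV_double (R : rcfType) (q : nat) (x : R) (j : nat) :
  lucasV q x (j * 2) = lucasV q x j ^+ 2 - 2 * q%:R ^+ j.
Proof.
have [a [b [ab xab]]] := lucasV_complex_root q x.
pose f : {rmorphism R -> complex R} := real_complex R.
have {}xab : a + b = f x by [].
apply: (fmorph_inj f).
rewrite -[LHS]lucasV_rmorph rmorphB rmorphXn [f (2 * _)]rmorphM rmorphXn !rmorph_nat.
rewrite -!(lucasV_rmorph f) -xab !lucasV_root //.
by rewrite -ab !exprM exprMn; ring.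
Qed.

Lemma lucasV_even_ge (R : rcfType) (q : nat) (x : R) (k : nat) : ~~ odd k ->
  - 2 * Num.sqrt q%:R ^+ k <= lucasV q x k.
Proof.
move=> ek; have -> : k = (k./2 * 2)%N by rewrite muln2 even_halfK.
by rewrite lucasV_double mulnC exprM sqr_sqrtr ?ler0n // mulNr lerDr sqr_ge0.
Qed.

Lemma lucasVN (R : rcfType) (q : nat) (x : R) (k : nat) : ~~ odd k ->
  lucasV q (- x) k = lucasV q x k.
Proof.
move=> ek; have [a [b [ab xab]]] := lucasV_complex_root q x.
pose f : {rmorphism R -> complex R} := real_complex R.
have {}xab : a + b = f x by [].
apply: (fmorph_inj f).
rewrite -!(lucasV_rmorph f) rmorphN -xab opprD !lucasV_root ?mulrNN //.
by rewrite (exprNn a) (exprNn b) -signr_odd (negPf ek) !mul1r.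
Qed.

(** Convexity of [t^k], whose slope at 1 is [k]: as [1 <= b <= x], the difference [x^k - b^k] is at
    least [k (x - b)], while [1 - y^k] is at most [k (1 - y)]. The hypothesis says that
    [1 - y < x - b]. *)
Lemma sum_expr_lt (R : realFieldType) (b x y : R) (k : nat) :
  1 <= b -> 0 <= y -> y <= 1 -> 1 + b < x + y -> (0 < k)%N ->
  1 + b ^+ k < x ^+ k + y ^+ k.
Proof.
move=> b1 y0 y1 bxy k0.
have bx : b <= x by lra.
have xb j : j%:R * (x - b) <= x ^+ j - b ^+ j.
  elim: j => [|j IH]; first by rewrite mul0r !expr0 subrr.
  have bj : 1 <= b ^+ j by apply: exprn_ege1.
  have jxb : 0 <= j%:R * (x - b) by apply: mulr_ge0 => //; lra.
  have h1 : 0 <= (x - 1) * (x ^+ j - b ^+ j) by apply: mulr_ge0; lra.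
  have h2 : 0 <= (x - b) * (b ^+ j - 1) by apply: mulr_ge0; lra.
  rewrite -natr1 !exprS mulrDl.
  move: (x ^+ j) (b ^+ j) (j%:R * (x - b)) IH h1 h2 jxb {bj} => X B J; lra.
have y1j j : 1 - y ^+ j <= j%:R * (1 - y).
  elim: j => [|j IH]; first by rewrite mul0r !expr0 subrr.
  have yj : y ^+ j <= 1 by apply: exprn_ile1.
  have h1 : 0 <= (1 - y) * (1 - y ^+ j) by apply: mulr_ge0; lra.
  rewrite -natr1 exprS mulrDl.
  move: (y ^+ j) (j%:R * (1 - y)) IH h1 {yj} => Y J; lra.
have kR : (0 : R) < k%:R by rewrite ltr0n.
have : k%:R * (1 - y) < k%:R * (x - b) by rewrite ltr_pM2l //; lra.
have := xb k; have := y1j k; lra.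
Qed.

Lemma abs_le_of_lucasV (R : realType) (q k : nat) (l M : R) :
  (0 < q)%N -> (0 < k)%N -> ~~ odd k -> 1 <= M ->
  2 * Num.sqrt q%:R < `|l| ->
  lucasV q l k <= (M + 1) * Num.sqrt q%:R ^+ k ->
  `|l| <= (1 + M `^ (k%:R^-1)) * Num.sqrt q%:R.
Proof.
move=> q0 k0 ek M1; set r := Num.sqrt q%:R => rl.
have r0 : 0 < r by rewrite sqrtr_gt0 ltr0n.
have rr : r ^+ 2 = q%:R by rewrite sqr_sqrtr ?ler0n.
have -> : lucasV q l k = lucasV q `|l| k.
  by case: (ger0P l) => // _; rewrite lucasVN.
pose z := `|l| / r; have lz : `|l| = r * z by rewrite /z mulrCA divff ?mulr1 ?gt_eqF.
rewrite lz; have z2 : 2 < z by rewrite /z ltr_pdivlMr.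
(* The roots [x] and [y] of [t^2 - z t + 1] are real because [z > 2]. Then [r x] and [r y] have
   product [q] and sum [|l|], as [lucasV_root] requires. *)
pose s := Num.sqrt (z ^+ 2 - 4).
have ss : s ^+ 2 = z ^+ 2 - 4 by rewrite sqr_sqrtr //; nra.
have s0 : 0 <= s by apply: sqrtr_ge0.
pose x := (z + s) / 2; pose y := (z - s) / 2.
have zxy : z = x + y by rewrite /x /y; lra.
have xy : x * y = 1 by rewrite /x /y; nra.
have sz : s < z by nra.
rewrite zxy mulrDr lucasV_root; last by rewrite mulrACA xy mulr1 -expr2.
rewrite (exprMn _ r x) (exprMn _ r y) -!mulrDr [(M + 1) * _]mulrC [_ * r]mulrC.
rewrite !ler_pM2l ?exprn_gt0 // => le.
set b := M `^ _; have bk : b ^+ k = M.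
  rewrite -powR_mulrn ?powR_ge0 // -powRrM mulVf ?pnatr_eq0 -?lt0n //.
  by rewrite powRr1 //; lra.
have b1 : 1 <= b.
  rewrite /b -[leLHS](powRr0 M); apply: ler_powR => //.
rewrite leNgt; apply/negP => bxy.
have y0 : 0 <= y by rewrite /y; lra.
have y1 : y <= 1.
  rewrite leNgt; apply/negP => y1; have : 1 < x by rewrite /x /y in y1 *; lra.
  nra.
have := sum_expr_lt b1 y0 y1 bxy k0.
by rewrite bk [1 + M]addrC ltNge le.
Qed.

(** * Real power series and logarithmic derivatives *)

Lemma cvg_pseries_diffs (R : realType) (a : R^nat) (r : R) :
  0 < r -> cvgn (pseries a r) -> cvgn (pseries (pseries_diffs a) (r / 4)).
Proof.
move=> r0 /cvg_series_bounded [K [_ Kb]].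
have {Kb} Kb n : `|a n * r ^+ n| <= `|K| + 1.
  by apply: Kb => //; rewrite (le_lt_trans (ler_norm K)) // ltrDl.
(* The terms at [r] are bounded by [|K| + 1]. Of the factor [4^-n] one half [2^-n] absorbs [n + 1],
   at the cost of a constant 2, and the other is the geometric ratio. *)
apply: normed_cvg; apply: (@series_le_cvg _ _ (geometric (2 * (`|K| + 1) / r) (2^-1))).
- by move=> n; exact: normr_ge0.
- move=> n; rewrite /= mulr_ge0 ?exprn_ge0 ?invr_ge0 //.
  by rewrite divr_ge0 ?mulr_ge0 ?addr_ge0 // ltW.
- move=> n; rewrite /= /pseries_diffs.
  rewrite (_ : n.+1%:R * a n.+1 * (r / 4) ^+ n =
    (n.+1%:R / 2 ^+ n) * ((a n.+1 * r ^+ n.+1) / r) * 2^-1 ^+ n); last first.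
    have -> : (r / 4) ^+ n = r ^+ n * (2^-1 ^+ n * 2^-1 ^+ n).
      by rewrite -!exprMn; congr (_ ^+ _); field.
    by rewrite exprS -exprVn; field; rewrite gt_eqF.
  rewrite normrM (@ger0_norm _ (2^-1 ^+ n)) ?exprn_ge0 ?invr_ge0 //.
  apply: ler_wpM2r; first by rewrite exprn_ge0 ?invr_ge0.
  rewrite normrM -[2 * _ * _]mulrA; apply: ler_pM => //.
    rewrite ger0_norm ?divr_ge0 ?exprn_ge0 //.
    rewrite ler_pdivrMr ?exprn_gt0 //. rewrite -exprS -natrX ler_nat.
    exact: ltnW (ltn_expl _ _).
  rewrite normrM (@ger0_norm _ r^-1) ?invr_ge0 ?(ltW r0) //.
  by apply: ler_wpM2r; rewrite ?invr_ge0 ?(ltW r0).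
apply: is_cvg_geometric_series; rewrite ger0_norm ?invr_ge0 // invf_lt1 //.
by rewrite ltr1n.
Qed.

(** Termwise differentiation by [pseries_snd_diffs] asks for convergence of the series and of its
    first two derived series at one radius. Each derivation costs a factor 4, whence [r / 16]. *)
Lemma is_derive_pseries (R : realType) (a : R^nat) (r x : R) :
  0 < r -> cvgn (pseries a r) -> `|x| < r / 16 ->
  is_derive x 1 (fun y => limn (pseries a y)) (limn (pseries (pseries_diffs a) x)).
Proof.
move=> r0 ca xr; have c1 := cvg_pseries_diffs r0 ca.
have r4 : 0 < r / 4 by rewrite divr_gt0.
have c2 := cvg_pseries_diffs r4 c1.
have E : r / 4 / 4 = r / 16 by field.
rewrite E in c2.
have a16 : `|r / 16| = r / 16 by rewrite ger0_norm // divr_ge0 // ltW.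
apply: (@pseries_snd_diffs _ _ (r / 16)) => //; last by rewrite a16.
- apply: is_cvg_pseries_inside ca _; rewrite a16 ger0_norm ?(ltW r0) //; lra.
- apply: is_cvg_pseries_inside c1 _; rewrite a16 ger0_norm ?(ltW r4) //; lra.
Qed.

(* By induction on [k]: differentiating the zero sum shifts the coefficients. *)
Lemma pseries_eq0 (R : realType) (d : R^nat) (r : R) : 0 < r ->
  (forall x, `|x| < r -> pseries d x @ \oo --> (0 : R)) -> forall k, d k = 0.
Proof.
move=> r0 d0 k; elim: k d r r0 d0 => [|k IH] d r r0 d0.
  have := d0 0; rewrite normr0 => /(_ r0) d00.
  suff : series (fun i => d i * 0 ^+ i) @ \oo --> d 0%N.
    by move=> /(cvg_unique _ d00) ->.
  apply: cvg_near_cst; near=> n.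
  rewrite /series /= -[n]prednK; last by near: n; exists 1%N.
  rewrite big_nat_recl // big1 ?addr0 ?expr0 ?mulr1 // => i _.
  by rewrite exprS mul0r mulr0.
have r2 : 0 < r / 2 by rewrite divr_gt0.
have c2 : cvgn (pseries d (r / 2)).
  by apply: cvgP (d0 _ _); rewrite ger0_norm ?ltW //; lra.
have c8 := cvg_pseries_diffs r2 c2.
have r32 : 0 < r / 2 / 16 by rewrite divr_gt0.
have C x : `|x| < r / 2 / 16 -> pseries (pseries_diffs d) x @ \oo --> (0 : R).
  move=> xr; have D := is_derive_pseries r2 c2 xr.
  have c : cvgn (pseries (pseries_diffs d) x).
    apply: is_cvg_pseries_inside c8 _.
    by rewrite (@ger0_norm _ (_ / 4)) ?divr_ge0 ?ltW //; lra.
  suff <- : limn (pseries (pseries_diffs d) x) = 0 by [].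
  have D0 : is_derive x 1 (cst 0 : R -> R) 0 by apply: is_derive_cst.
  have : is_derive x 1 (fun y => limn (pseries d y)) (0 : R).
    apply: near_eq_is_derive D0; near=> y; apply/esym/cvg_lim => //.
    apply: d0; rewrite (@lt_trans _ _ (r / 2 / 16)) //; last by lra.
    by near: y; apply: (@cvgr_norm_lt _ _ _ _ _ idfun x) => //; exact: cvg_id.
  by move=> E; rewrite -(@derive_val _ _ _ _ _ _ _ D) (@derive_val _ _ _ _ _ _ _ E).
have /eqP := IH _ _ r32 C; rewrite /pseries_diffs.
by rewrite mulf_eq0 pnatr_eq0 /= => /eqP.
Unshelve. all: by end_near. Qed.

Lemma is_derive_sum_ln (R : realType) (cs : seq R) (x : R) :
  {in cs, forall c, 0 < 1 - c * x} ->
  is_derive x 1 (fun y => \sum_(c <- cs) ln (1 - c * y))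
    (- \sum_(c <- cs) c / (1 - c * x)).
Proof.
elim: cs => [|c cs IH] cx.
  under eq_fun => y do rewrite big_nil.
  by rewrite big_nil oppr0; apply: is_derive_cst.
under eq_fun => y do rewrite big_cons.
rewrite big_cons opprD; apply: is_deriveD; last first.
  by apply: IH => c' c'cs; apply: cx; rewrite in_cons c'cs orbT.
have c0 : 0 < 1 - c * x by apply: cx; rewrite mem_head.
rewrite (_ : - (c / _) = (1 - c * x)^-1 * - c); last by rewrite mulrN mulrC.
apply: (@is_derive1_comp _ (@ln R) (fun y => 1 - c * y)).
  exact: is_derive1_ln.
have := is_deriveB (is_derive_cst (1 : R) x 1) (is_deriveZ c (is_derive_id x (1 : R))).
by rewrite sub0r /GRing.scale /= mulr1.
Qed.

(** The logarithm of the product identity is [f + s + sum_c ln (1 - c x) = 0]. It is differentiated,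
    each [c / (1 - c x)] is expanded as a geometric series, and [pseries_eq0] compares
    coefficients. *)
Lemma log_derivative_coef (R : realType) (cs : seq R) (a b : R^nat)
    (f g s : R -> R) (r : R) : 0 < r ->
  {in cs, forall c, `|c| * r < 1} ->
  (forall x : R, `|x| < r -> is_derive x 1 f (g x)) ->
  (forall x, `|x| < r -> pseries a x @ \oo --> g x) ->
  (forall x, `|x| < r -> pseries b x @ \oo --> s x) ->
  (forall x, `|x| < r ->
    expR (f x) * (\prod_(c <- cs) (1 - c * x)) * expR (s x) = 1) ->
  forall k, a k = \sum_(c <- cs) c ^+ k.+1 - pseries_diffs b k.
Proof.
move=> r0 csr df sa sb fPs k.
have cx (x c : R) : `|x| < r -> c \in cs -> `|c * x| < 1.
  move=> xr ccs; apply: le_lt_trans (csr _ ccs).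
  by rewrite normrM ler_wpM2l // ltW.
have cx0 (x c : R) : `|x| < r -> c \in cs -> 0 < 1 - c * x.
  by move=> xr ccs; rewrite subr_gt0 (le_lt_trans (ler_norm _)) // cx.
have sum0 (x : R) : `|x| < r -> f x + s x + \sum_(c <- cs) ln (1 - c * x) = 0.
  move=> xr; apply: expR_inj; rewrite expR0 !expRD -[RHS](fPs x xr) mulrAC.
  congr (_ * _ * _); rewrite expR_sum; apply: eq_big_seq => c ccs.
  by rewrite lnK // posrE cx0.
have r2 : 0 < r / 2 by rewrite divr_gt0.
have r2r : `|r / 2| < r by rewrite ger0_norm ?ltW //; lra.
have cb : cvgn (pseries b (r / 2)) by apply: cvgP (sb _ r2r).
have r32 : 0 < r / 2 / 16 by rewrite divr_gt0.
suff /(_ k) /eqP : forall k, a k + pseries_diffs b k - \sum_(c <- cs) c ^+ k.+1 = 0.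
  by rewrite subr_eq0 => /eqP <-; rewrite addrK.
apply: (pseries_eq0 r32) => x xr.
have xr' : `|x| < r by apply: lt_trans xr _; lra.
have cdb : cvgn (pseries (pseries_diffs b) x).
  apply: is_cvg_pseries_inside (cvg_pseries_diffs r2 cb) _.
  by rewrite (@ger0_norm _ (_ / 4)) ?divr_ge0 ?ltW //; lra.
have geo (c : R) : c \in cs ->
    series (fun j => c ^+ j.+1 * x ^+ j) @ \oo --> c / (1 - c * x).
  move=> ccs; have := @cvg_geometric_series R c (c * x) (cx _ _ xr' ccs).
  apply: cvg_trans; apply: near_eq_cvg; near=> n; apply: eq_bigr => j _.
  by rewrite /= exprMn exprS mulrA.
have E : g x + limn (pseries (pseries_diffs b) x) - \sum_(c <- cs) c / (1 - c * x) = 0.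
  have D1 := is_derive_pseries r2 cb xr.
  have D2 : is_derive x 1 (fun y => \sum_(c <- cs) ln (1 - c * y))
    (- \sum_(c <- cs) c / (1 - c * x)).
    by apply: is_derive_sum_ln => c ccs; apply: cx0.
  have D := is_deriveD (is_deriveD (df x xr') D1) D2.
  have D0 : is_derive x 1 (cst 0 : R -> R) 0 by apply: is_derive_cst.
  rewrite -(@derive_val _ _ _ _ _ _ _ D) -[RHS](@derive_val _ _ _ _ _ _ _ D0).
  apply: near_eq_derive; near=> y.
  have yr : `|y| < r.
    by near: y; apply: (@cvgr_norm_lt _ _ _ _ _ idfun x) => //; exact: cvg_id.
  by rewrite !fctE (cvg_lim _ (sb y yr)) //; exact: sum0.
have sumgeo : series (fun j => (\sum_(c <- cs) c ^+ j.+1) * x ^+ j) @ \oo -->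
    \sum_(c <- cs) c / (1 - c * x).
  elim: cs geo {csr cx cx0 sum0 fPs E} => [|c cs IH] geo.
    rewrite big_nil; apply: cvg_near_cst; near=> n.
    by apply: big1 => j _; rewrite big_nil mul0r.
  rewrite big_cons.
  under [X in series X]eq_fun => j do rewrite big_cons mulrDl.
  rewrite -[X in series X]/((fun j => c ^+ j.+1 * x ^+ j) +
    (fun j => (\sum_(c <- cs) c ^+ j.+1) * x ^+ j)) seriesD.
  apply: cvgD; first by apply: geo; rewrite mem_head.
  by apply: IH => c' c'cs; apply: geo; rewrite in_cons c'cs orbT.
have : series ((fun j => a j * x ^+ j) + (fun j => pseries_diffs b j * x ^+ j) -
    (fun j => (\sum_(c <- cs) c ^+ j.+1) * x ^+ j)) @ \oo -->
    g x + limn (pseries (pseries_diffs b) x) - \sum_(c <- cs) c / (1 - c * x).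
  rewrite seriesD seriesN seriesD; apply: cvgB => //; apply: cvgD => //.
  exact: sa.
rewrite E; apply: cvg_trans; apply: near_eq_cvg; near=> n; apply: eq_bigr => j _.
by rewrite /= !fctE mulrBl mulrDl.
Unshelve. all: by end_near. Qed.

(** * Restriction of complex functions and series to the real axis *)

Lemma normr_toC (R : realType) (x : R) : `|toC x| = toC `|x|.
Proof. by rewrite normc_def /= expr0n addr0 sqrtr_sqr. Qed.

Lemma normr_cexp (R : realType) (z : Cplx R) : `|cexp z| = toC (expR (complex.Re z)).
Proof.
rewrite /cexp normrM normr_toC (ger0_norm (expR_ge0 _)) [X in _ * X]normc_def /=.
by rewrite cos2Dsin2 sqrtr1 mulr1.
Qed.

Lemma ltr_toC (R : realType) (x y : R) : (toC x < toC y) = (x < y).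
Proof. by rewrite ltcR. Qed.

Lemma gt0_toC (R : realType) (e : Cplx R) : 0 < e -> exists2 d : R, 0 < d & e = toC d.
Proof.
case: e => a b; rewrite ltcE /= => /andP [/eqP -> a0].
by exists a.
Qed.

Lemma near0_toC (R : realType) (P : Cplx R -> Prop) :
  (\forall u \near (0 : Cplx R), P u) ->
  exists2 r : R, 0 < r & forall x, `|x| < r -> P (toC x).
Proof.
move=> /nbhs_normP [e /gt0_toC [d d0 ->] dP]; exists d => // x xd.
by apply: dP; rewrite /= sub0r normrN normr_toC ltr_toC.
Qed.

Lemma normr_Re_lt (R : realType) (z : Cplx R) (e : R) :
  `|z| < toC e -> `|complex.Re z| < e.
Proof. by move=> ze; rewrite -ltr_toC (le_lt_trans (normc_ge_Re z)). Qed.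

Lemma cvg_series_Re (R : realType) (u : nat -> Cplx R) (S : Cplx R) :
  series u @ \oo --> S ->
  series (fun k => complex.Re (u k)) @ \oo --> complex.Re S.
Proof.
move=> /cvgrPdist_lt uS; apply/cvgrPdist_lt => e e0.
have e0' : 0 < toC e by rewrite -[0]/(toC 0) ltr_toC.
near=> n; rewrite (_ : _ - _ = complex.Re (S - series u n)).
  by apply: normr_Re_lt; near: n; exact: uS.
by rewrite raddfB; congr (_ - _); rewrite /series /= raddf_sum.
Unshelve. all: by end_near. Qed.

(** For real increments, the real part of the complex difference quotient is the difference quotient
    of the real part. *)
Lemma is_derive_Re_toC (R : realType) (L : Cplx R -> Cplx R) (x : R) :
  derivable L (toC x) 1 ->
  is_derive x 1 (fun y => complex.Re (L (toC y))) (complex.Re (L^`() (toC x))).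
Proof.
rewrite derive1E => dL; set l := 'D_1 L _.
have {dL} : h^-1 *: (L (h *: 1 + toC x) - L (toC x)) @[h --> (0 : Cplx R)^'] --> l.
  exact: dL.
move=> /cvgrPdist_lt Ll.
have {Ll} fl : h^-1 *: (complex.Re (L (toC (h *: 1 + x))) - complex.Re (L (toC x)))
    @[h --> (0 : R)^'] --> complex.Re l.
  apply/cvgrPdist_lt => e e0.
  have e0' : 0 < toC e by rewrite -[0]/(toC 0) ltr_toC.
  have /near0_toC [r r0 rP] := Ll _ e0'.
  near=> h.
  have h0 : h != 0 by near: h; exact: nbhs_dnbhs_neq.
  have hr : `|h| < r by near: h; exact: dnbhs0_lt.
  have th0 : toC h != 0 by rewrite (inj_eq (@complexI R)).
  have := rP h hr th0; rewrite /= => /normr_Re_lt.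
  rewrite raddfB /=; congr (`|_ - _| < _).
  have -> : toC h *: (1 : Cplx R) + toC x = toC (h *: 1 + x).
    by rewrite /GRing.scale /= !mulr1 -[RHS]/(real_complex R _) rmorphD.
  rewrite -[(toC h)^-1]/((real_complex R h)^-1) -fmorphV -raddfB.
  by case: (_ - _) => a c; rewrite /GRing.scale /= mul0r subr0.
apply: DeriveDef; first exact: cvgP fl.
exact: cvg_lim fl.
Unshelve. all: by end_near. Qed.

Lemma ler_sum_norm_mem (R : realDomainType) (cs : seq R) (c : R) :
  c \in cs -> `|c| <= \sum_(a <- cs) `|a|.
Proof. by move=> ccs; rewrite (big_rem c) //= lerDl sumr_ge0. Qed.

Lemma cvg_geodesic_pseries (R : realType) (X : multigraph) (s x : R) (S : Cplx R) :
  series (fun k : nat => (num_geodesic X k.+1)%:R / k.+1%:R * toC (s * x) ^+ k.+1)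
    @ \oo --> S ->
  pseries (fun k => (num_geodesic X k)%:R / k%:R * s ^+ k) x @ \oo --> complex.Re S.
Proof.
move=> /cvg_series_Re; set u := series _ => uS.
rewrite -cvg_shiftS; apply: cvg_trans uS; apply: near_eq_cvg; near=> n.
(* The term of index 0 vanishes because the inverse of 0 is 0, so the real series may start at 0. *)
rewrite /pseries /series /= big_nat_recl // invr0 mulr0 !mul0r add0r.
rewrite /u /series /=; apply: eq_bigr => k _.
transitivity (complex.Re (toC ((num_geodesic X k.+1)%:R / k.+1%:R * (s * x) ^+ k.+1))).
  congr complex.Re; rewrite -[RHS]/(real_complex R _) rmorphM fmorph_div /= rmorphXn.
  by rewrite !rmorph_nat.
by rewrite /= exprMn mulrA.
Unshelve. all: by end_near. Qed.

Lemma log_xi_coef (R : realType) (X : multigraph) (D : set (Cplx R))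
    (Z F L : Cplx R -> Cplx R) (s : R) (cs : seq R) (h : nat -> R) (k : nat) :
  is_ihara_zeta X D Z -> is_log_near0 F L ->
  is_maclaurin (fun u => L^`() u) (fun k : nat => toC (h k.+1)) ->
  (forall x, F (toC x) = (toC (\prod_(c <- cs) (1 - c * x)) * Z (toC (s * x)))^-1) ->
  0 < s -> (0 < k)%N ->
  h k = \sum_(c <- cs) c ^+ k - s ^+ k * (num_geodesic X k)%:R.
Proof.
case=> _ _ _ /near0_toC [rz rz0 hZ] /near0_toC [rl rl0 hL] /near0_toC [rh rh0 hh] FE s0.
case: k => // k _.
pose M : R := 1 + \sum_(c <- cs) `|c|.
have M0 : 0 < M by rewrite /M ltr_pwDl // sumr_ge0.
(* Three of the radii come from the local hypotheses; that of the zeta function is divided by [s],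
   since [Z] is taken at [s x]. The fourth, [M^-1], ensures [|c| r < 1]. *)
pose r := Num.min (Num.min (rz / s) rl) (Num.min rh M^-1).
have r0 : 0 < r by rewrite !lt_min divr_gt0 // rl0 rh0 invr_gt0.
have rP x : x < r -> [/\ x < rz / s, x < rl, x < rh & x < M^-1].
  by rewrite !lt_min => /andP [/andP [-> ->] /andP [-> ->]].
have hz x : `|x| < r -> exists S : Cplx R,
  series (fun k : nat => (num_geodesic X k.+1)%:R / k.+1%:R * toC (s * x) ^+ k.+1)
    @ \oo --> S /\ Z (toC (s * x)) = cexp S.
  move=> /rP [xz _ _ _]; apply: hZ.
  by rewrite normrM (gtr0_norm s0) mulrC -ltr_pdivlMr.
pose S x := if pselect (`|x| < r) is left xr then projT1 (cid (hz x xr)) else 0.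
have SP x : `|x| < r ->
  series (fun k : nat => (num_geodesic X k.+1)%:R / k.+1%:R * toC (s * x) ^+ k.+1)
    @ \oo --> S x /\ Z (toC (s * x)) = cexp (S x).
  by move=> xr; rewrite /S; case: pselect => // xr'; case: cid.
have csr : {in cs, forall c, `|c| * r < 1}.
  move=> c ccs; have rM : r <= M^-1 by rewrite /r !ge_min lexx !orbT.
  apply: (@le_lt_trans _ _ (`|c| * M^-1)); first by apply: ler_wpM2l.
  rewrite ltr_pdivrMr // mul1r /M; have := ler_sum_norm_mem ccs; lra.
pose b (k : nat) : R := (num_geodesic X k)%:R / k%:R * s ^+ k.
have -> : s ^+ k.+1 * (num_geodesic X k.+1)%:R = pseries_diffs b k.
  by rewrite /pseries_diffs /b mulrA mulrCA divff ?pnatr_eq0 // mulr1 mulrC.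
apply: (@log_derivative_coef R cs (fun k => h k.+1) b
  (fun x => complex.Re (L (toC x))) (fun x => complex.Re (L^`() (toC x)))
  (fun x => complex.Re (S x)) r) => //.
- by move=> x /rP [_ xl _ _]; apply: is_derive_Re_toC; have [] := hL x xl.
- move=> x /rP [_ _ xh _]; have /cvg_series_Re := hh x xh.
  apply: cvg_trans; apply: near_eq_cvg; near=> n; apply: eq_bigr => j _.
  rewrite -[toC x ^+ j]/(real_complex R x ^+ j) -rmorphXn /=.
  by rewrite mul0r subr0.
- by move=> x xr; apply: cvg_geodesic_pseries; have [] := SP x xr.
move=> x xr; have [_ zE] := SP x xr; have [_ xl _ _] := rP _ xr.
(* Since [|exp z| = exp (Re z)], absolute values leave an identity between real parts, independent
   of the branch of the logarithm. *)
have [_ ] := hL x xl; rewrite FE zE => /(congr1 Num.norm).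
set P := \prod_(c <- cs) _.
have P0 : 0 < P.
  rewrite /P big_seq_cond; apply: prodr_gt0 => c /andP [ccs _].
  rewrite subr_gt0 (le_lt_trans (ler_norm _)) // (le_lt_trans _ (csr _ ccs)) //.
  by rewrite normrM ler_wpM2l // ltW.
rewrite normfV normr_cexp normrM normr_cexp normr_toC (gtr0_norm P0).
rewrite -[toC P * _]/(real_complex R P * real_complex R _) -rmorphM -fmorphV.
move=> /(@complexI R) ->.
by rewrite -mulrA mulVf // mulf_neq0 ?gt_eqF ?expR_gt0.
Unshelve. all: by end_near. Qed.

(** * Factors of the rescaled xi function *)

Lemma prodr_nseq (R : pzSemiRingType) (T : Type) (m : nat) (c : T) (F : T -> R) :
  \prod_(a <- nseq m c) F a = F c ^+ m.
Proof. by rewrite big_nseq iter_mulr mulr1. Qed.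

Lemma sumr_nseq (V : nmodType) (T : Type) (m : nat) (c : T) (F : T -> V) :
  \sum_(a <- nseq m c) F a = F c *+ m.
Proof. by rewrite big_nseq iter_addr addr0. Qed.

Lemma half_regular (X : multigraph) (q : nat) :
  (0 < q)%N -> regular_graph X q.+1 ->
  ((graph_order X * (q - 1))./2 * 2 = graph_order X * (q - 1))%N.
Proof.
move=> q0 hreg; rewrite muln2 even_halfK //.
have : odd (graph_order X * q.+1) = false.
  by rewrite -(card_oedge hreg) card_prod card_bool oddM andbF.
by rewrite !oddM -[in q.+1](subnK q0) addn1 /= negbK => ->.
Qed.

(** At [u = x / r] with [r^2 = q], the factors [1 - u], [1 - q u] and [1 - r u] become [1 - x / r],
    [1 - r x] and [1 - x]. The factors [1 - u^2] and [1 - q^2 u^2] split with the pairs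
    [r^-1, - r^-1] and [r, - r]. *)
Lemma ihara_xi_real (R : realType) (X : multigraph) (q : nat)
    (Z : Cplx R -> Cplx R) (x : R) :
  let r : R := Num.sqrt q%:R in
  let n := graph_order X in
  let m := (n * (q - 1))./2 in
  let cs := if `[< bipartite X >]
            then [:: r; - r] ++ nseq (2 * n - 4) 1
                   ++ nseq (m + 1) r^-1 ++ nseq (m + 1) (- r^-1)
            else [:: r^-1; r] ++ nseq (2 * n - 2) 1
                   ++ nseq m r^-1 ++ nseq m (- r^-1) in
  (0 < q)%N ->
  ihara_xi X q Z (toC r^-1 * toC x) =
  (toC (\prod_(c <- cs) (1 - c * x)) * Z (toC (r^-1 * x)))^-1.
Proof.
move=> r n m cs q0; rewrite /ihara_xi -/n -/m -/r.
have r0 : r != 0 by rewrite gt_eqF // sqrtr_gt0 ltr0n.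
have qr : q%:R = r ^+ 2 by rewrite sqr_sqrtr ?ler0n.
pose f : {rmorphism R -> complex R} := real_complex R.
have -> : q%:R = f r ^+ 2 :> Cplx R by rewrite -rmorphXn -qr rmorph_nat.
have -> : toC r^-1 * toC x = f (r^-1 * x) by rewrite rmorphM.
rewrite -[toC (r^-1 * x)]/(f (r^-1 * x)) -[toC r]/(f r).
set z := Z _.
have fr u : f r * f (r^-1 * u) = f u by rewrite -rmorphM mulrA divff ?mul1r.
have fq : f r ^+ 2 * f (r^-1 * x) = f (r * x).
  by rewrite expr2 -mulrA fr rmorphM.
have q2 : (f r ^+ 2) ^+ 2 * f (r^-1 * x) ^+ 2 = f (r * x) ^+ 2.
  by rewrite -exprMn fq.
rewrite /cs; case: ifP => _; congr ((_ * z)^-1);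
  rewrite !big_cat /= !big_cons big_nil !prodr_nseq mulr1 mul1r.
  have fE a b i j : f ((1 - a ^+ 2) * ((1 - x) ^+ i * (1 - b ^+ 2) ^+ j)) =
      (1 - f a ^+ 2) * (1 - f x) ^+ i * (1 - f b ^+ 2) ^+ j.
    by rewrite 2!rmorphM 2!(rmorphXn f _ (1 - _)) 3!rmorphB rmorph1 2!rmorphXn mulrA.
  rewrite q2 fr -fE -[RHS]/(f _); congr (f _).
  rewrite -!mulrA -exprMn [in RHS]mulrA; congr (_ * (_ * _ ^+ _)); ring.
have fE b c i j : f ((1 - b) * ((1 - c) * ((1 - x) ^+ i * (1 - b ^+ 2) ^+ j))) =
    (1 - f b) * (1 - f c) * (1 - f x) ^+ i * (1 - f b ^+ 2) ^+ j.
  by rewrite 3!rmorphM 2!(rmorphXn f _ (1 - _)) 4!rmorphB rmorph1 rmorphXn !mulrA.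
rewrite fq fr -fE -[RHS]/(f _); congr (f _).
rewrite -!mulrA -exprMn; congr (_ * (_ * (_ * _ ^+ _))); ring.
Qed.

(** * Trace estimate and conclusion *)

Lemma ler_sum_uniq (R : numDomainType) (I : finType) (s : seq I) (F : I -> R) :
  uniq s -> (forall i, 0 <= F i) -> \sum_(i <- s) F i <= \sum_i F i.
Proof.
move=> us F0; rewrite big_uniq // [leRHS](bigID [in s]) /= lerDl.
exact: sumr_ge0.
Qed.

(* The case [a < 0] covers [a = 2n - 7] with [n = 3], where the junk value
   [ln a = 0] makes the power equal to [1]. *)
Lemma ge1_powR (R : realType) (a x : R) : 0 <= x -> a < 0 \/ 1 <= a -> 1 <= a `^ x.
Proof.
move=> x0 [a0|a1]; last by rewrite -[leLHS](powRr0 a) ler_powR.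
by rewrite /powR lt_eqF // ln0 ?(ltW a0) // mulr0 expR0.
Qed.

Lemma lucasV_trivial (R : comPzRingType) (q k : nat) :
  lucasV q (q%:R + 1 : R) k = q%:R ^+ k + 1.
Proof. by rewrite lucasV_root ?mulr1 // expr1n. Qed.

(** Each discarded index contributes at least [-2 q^(k/2)]. Shifting all terms by [2 q^(k/2)] makes
    them nonnegative, so that a partial sum bounds the full one. *)
Lemma lucasV_sum_ge (R : realType) (q n k : nat) (d : 'I_n -> R) (s : seq 'I_n) :
  ~~ odd k -> uniq s ->
  \sum_(i <- s) lucasV q (d i) k - 2 * (n%:R - (size s)%:R) * Num.sqrt q%:R ^+ k <=
  \sum_i lucasV q (d i) k.
Proof.
move=> ek us; set Q := Num.sqrt _ ^+ k.
have := @ler_sum_uniq _ _ _ (fun i => lucasV q (d i) k + 2 * Q) us.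
rewrite !big_split /= sumr_const card_ord.
rewrite (_ : \sum_(i <- s) 2 * Q = 2 * Q *+ size s); last first.
  by rewrite big_const_seq count_predT iter_addr addr0.
rewrite -(mulr_natl _ n) -(mulr_natl _ (size s)).
have le i : 0 <= lucasV q (d i) k + 2 * Q.
  by have := lucasV_even_ge q (d i) ek; rewrite -/Q; lra.
by move=> /(_ le); lra.
Qed.

Theorem theorem1p2 (R : realType) (q n : nat) (X : multigraph)
    (hq : (1 <= q)%N) (hn : (3 <= n)%N)
    (hX : graph_order X = n) (hreg : regular_graph X q.+1) (hconn : connected_graph X)
    (D : set (Cplx R)) (Z : Cplx R -> Cplx R) (hZ : is_ihara_zeta X D Z)
    (L : Cplx R -> Cplx R)
    (hL : is_log_near0
            (fun u => ihara_xi X q Z (toC ((Num.sqrt q%:R)^-1) * u)) L)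
    (h : nat -> R)
    (hh : is_maclaurin (fun u => L^`() u) (fun k : nat => toC (h k.+1)))
    (k : nat) (hk0 : (0 < k)%N) (hk2 : ~~ odd k) (hk : 0 <= h k)
    (l : R) (hl : nontrivial_eigenvalue X q l) :
  (~ bipartite X ->
     `|l| <= (1 + (4 * n%:R - 7) `^ (k%:R^-1)) * Num.sqrt q%:R) /\
  (bipartite X ->
     `|l| <= (1 + (2 * n%:R - 7) `^ (k%:R^-1)) * Num.sqrt q%:R).
Proof.
subst n.
have r0 : 0 < Num.sqrt (q%:R : R) by rewrite sqrtr_gt0 ltr0n.
have := log_xi_coef hZ hL hh (fun x => @ihara_xi_real R X q Z x hq).
rewrite invr_gt0 => /(_ k r0 hk0).
rewrite (num_geodesic_lucas R hreg hk0 hk2).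
have [d [dtr deig]] := real_symmetric_spectrum q (tr_adjacency R X).
have half := half_regular hq hreg.
case: hl => hl ltriv.
have X0 : (0 < graph_order X)%N by rewrite (leq_trans _ hn).
have [i0 di0] := deig _ (eigenvalue_valency R hreg X0).
have [i1 di1] := deig _ hl.
rewrite dtr => hE; set n := graph_order X in d dtr deig i0 di0 i1 di1 half hn hE *.
set r := Num.sqrt (q%:R : R) in r0 hE *; set m := (_./2)%N in half hE *.
have rr : r ^+ 2 = q%:R by rewrite sqr_sqrtr ?ler0n.
have m2 : m%:R * 2 = n%:R * (q%:R - 1) :> R by rewrite -natrM half natrM natrB.
have rk : r ^+ k * r^-1 ^+ k = 1 by rewrite -exprMn divff ?gt_eqF // expr1n.
have r2k : r ^+ k * r ^+ k = q%:R ^+ k by rewrite -exprMn -expr2 rr.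
have rk0 : 0 < r ^+ k by rewrite exprn_gt0.
have Nk x : (- x) ^+ k = x ^+ k :> R by rewrite exprNn -signr_odd (negPf hk2) mul1r.
have kinv : 0 <= k%:R^-1 :> R by rewrite invr_ge0.
(* For [|l| <= 2 r] the bound holds because its power is at least 1. *)
have small (a : R) : a < 0 \/ 1 <= a -> `|l| <= 2 * r ->
    `|l| <= (1 + a `^ k%:R^-1) * r.
  move=> ha lr; apply: le_trans lr _; rewrite ler_pM2r //.
  by have := ge1_powR kinv ha; lra.
have n3 : (3 : R) <= n%:R by rewrite ler_nat.
rewrite -natr1 in di0.
have lq : l != q%:R + 1.
  by apply/eqP => lq; apply: ltriv; rewrite lq ger0_norm // addr_ge0.
have lNq : l != - (q%:R + 1).
  by apply/eqP => lq'; apply: ltriv; rewrite lq' normrN ger0_norm // addr_ge0.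
have Vtriv : lucasV q (q%:R + 1) k = r ^+ k * r ^+ k + 1 :> R.
  by rewrite lucasV_trivial r2k.
(* The factor [r^k] clears the powers [r^-k] coming from the trivial zeros and from the rescaling of
   [N_k]. *)
have hQ : 0 <= h k * r ^+ k by rewrite mulr_ge0 // ltW.
have sum_ge := fun s => @lucasV_sum_ge R q n k d s hk2.
split=> bip.
- have n7 : (1 : R) <= 4 * n%:R - 7 by lra.
  have [lr|lr] := leP `|l| (2 * r); first by apply: small => //; right.
  apply: abs_le_of_lucasV => //.
  rewrite asboolF // in hE; move: hQ.
  rewrite hE !big_cat /= !big_cons big_nil !sumr_nseq Nk expr1n.
  have -> : (2 * n - 2)%:R = 2 * n%:R - 2 :> R.
    by rewrite natrB ?natrM // -[leqLHS]muln1 leq_mul2l X0.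
  have := sum_ge [:: i0; i1]; rewrite /= !inE andbT.
  have -> : i0 != i1 by apply: contra lq => /eqP i01; rewrite -di1 -i01 di0.
  rewrite !big_cons big_nil di0 di1 Vtriv -/r => /(_ isT).
  move: (\sum_i _) => T sumT; rewrite -(mulr_natl _ m) => hQ.
  have {hQ} : 0 <= (r ^+ k * r^-1 ^+ k) * (1 + m%:R * 2 - T - n%:R * (q%:R - 1))
      + r ^+ k * r ^+ k + (2 * n%:R - 2) * r ^+ k.
    by apply: le_trans hQ _; rewrite le_eqVlt; apply/orP; left; apply/eqP; ring.
  (* As [2m = n(q-1)], [hQ] reads [T <= q^k + 1 + (2n-2) r^k]. The lower bound on [T] cancels
     [q^k + 1] and leaves [p_k(l) <= (2n-2 + 2(n-2)) r^k], that is [(4n-7 + 1) r^k]. *)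
  rewrite rk m2; move: sumT; rewrite /=; lra.
have [lr|lr] := leP `|l| (2 * r).
  apply: small => //; have [n4|] := leqP 4 n.
    by right; have : (4 : R) <= n%:R by [rewrite ler_nat]; lra.
  by rewrite ltnS => n3'; left; have : n%:R <= (3 : R) by [rewrite ler_nat]; lra.
have n1 : (1 < n)%N by rewrite (leq_trans _ hn).
have [c hc] := bipartite_colouring hconn n1 bip.
have [i2 di2] := deig _ (eigenvalue_opp_colouring hc hl).
have := eigenvalue_opp_colouring hc (eigenvalue_valency R hreg X0).
rewrite -natr1 => /deig [i3 di3].
have l0 : l != 0.
  by apply/eqP => l0; move: lr; rewrite l0 normr0 => lr; lra.
(* The indices differ because their eigenvalues do: [l] is nontrivial, and nonzero since
   [|l| > 2 r]. *)
have us : uniq [:: i0; i3; i1; i2].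
  apply: (@map_uniq _ _ d); rewrite /= di0 di1 di2 di3 !inE !negb_or !andbT.
  have q1 : (0 : R) < q%:R + 1 by rewrite ltr_wpDl.
  have Nneq (x : R) : x != 0 -> x != - x.
    by move=> x0; apply: contra x0 => /eqP xx; apply/eqP; lra.
  rewrite (inj_eq oppr_inj) ![_ + 1 == _]eq_sym ![- (_ + 1) == l]eq_sym.
  by rewrite !eqr_oppLR lq !lNq !Nneq ?(gt_eqF q1).
(* Four distinct indices force [n >= 4], so that [2n - 7] is at least 1. *)
have n4 : (4 : R) <= n%:R.
  rewrite ler_nat -(size_enum_ord n).
  by apply: (uniq_leq_size us) => i _; rewrite mem_enum.
apply: abs_le_of_lucasV => //; first by lra.
rewrite asboolT // in hE; move: hQ.
rewrite hE !big_cat /= !big_cons big_nil !sumr_nseq !Nk expr1n.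
have -> : (2 * n - 4)%:R = 2 * n%:R - 4 :> R.
  by rewrite natrB ?natrM // -[leqLHS]/(2 * 2)%N leq_mul2l n1.
have := sum_ge _ us.
rewrite !big_cons big_nil di0 di1 di2 di3 !lucasVN // Vtriv -/r.
move: (\sum_i _) => T sumT; rewrite -(mulr_natl _ (m + 1)) natrD => hQ.
have {hQ} : 0 <= (r ^+ k * r^-1 ^+ k) * ((m%:R * 2 + 2) - T - n%:R * (q%:R - 1))
    + 2 * (r ^+ k * r ^+ k) + (2 * n%:R - 4) * r ^+ k.
  by apply: le_trans hQ _; rewrite le_eqVlt; apply/orP; left; apply/eqP; ring.
(* The pairs of opposite eigenvalues give [2 p_k(l) <= (2n-4 + 2(n-4)) r^k], hence
   [p_k(l) <= (2n-7 + 1) r^k]. *)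
rewrite rk m2; move: sumT; rewrite /=; lra.
Qed.
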